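(* Let $\{\mathcal{R}_A\}=\{\sim_A\}$ and let $\zeta$ be its associated zero-divisor functor. Let $A$ be a total ring and let $B_1,B_2$ be rings such that $\zeta(A)\simeq\zeta(B_1)\times\zeta(B_2)$, with $\zeta(B_1),\zeta(B_2)\not\simeq\zeta(\mathbf{0})$. Then $A\simeq A_1\times A_2$, where $A_1,A_2$ are quotients of $A$ such that $\zeta(A_1)\simeq\zeta(B_1)$ and $\zeta(A_2)\simeq\zeta(B_2)$.
   Context: All rings are commutative and unitary; $\mathbf{0}$ is the zero ring. For $a,b$ in a ring $A$, $a\sim_A b$ iff $(a)=(b)$ as ideals. $\zeta(A)$ is the graph (loops allowed) with vertex set $A/\!\sim_A$ in which $[a],[b]$ are adjacent iff $ab=0$ (well defined). The product $G_1\times G_2$ of graphs has vertex set $V(G_1)\times V(G_2)$, with two pairs adjacent iff both components are adjacent; $\simeq$ denotes isomorphism of graphs (bijection on vertices preserving adjacency in both directions) or of rings. A ring $A$ is total if every regular element (non-zero-divisor) of $A$ is invertible, equivalently $A$ is isomorphic to its total ring of fractions. *)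

(* Defs.v *)
From HB Require Import structures.
From mathcomp Require Import all_boot all_order all_algebra.
From mathcomp Require Import boolp.

Set Implicit Arguments.
Unset Strict Implicit.
Unset Printing Implicit Defensive.

Import GRing.Theory.

Local Open Scope ring_scope.
Local Open Scope quotient_scope.

(* Undirected graphs, possibly infinite, with loops allowed. *)
Record graph := Graph {
  vertex :> Type;
  adj : rel vertex;
  adjC : symmetric adj
}.

Definition graph_iso (G H : graph) : Prop :=
  exists2 f : G -> H, bijective f & {mono f : x y / adj x y}.

Section GraphProduct.
Variables G H : graph.

Definition prod_adj : rel (G * H) :=
  fun p q => adj p.1 q.1 && adj p.2 q.2.

Lemma prod_adjC : symmetric prod_adj.
Proof. by move=> p q; rewrite /prod_adj adjC [adj p.2 _]adjC. Qed.

Definition graph_prod : graph := Graph prod_adjC.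
End GraphProduct.

(* Rings are terms of [comPzRingType], which, unlike [comNzRingType], includes
   the zero ring; it carries no predicate for invertible elements. *)
Definition ring_iso (A B : comPzRingType) : Prop :=
  exists f : {rmorphism A -> B}, bijective f.

Definition regular (A : comPzRingType) (a : A) : Prop :=
  forall b : A, a * b = 0 -> b = 0.

Definition invertible (A : comPzRingType) (a : A) : Prop :=
  exists b : A, a * b = 1.

Definition total_ring (A : comPzRingType) : Prop :=
  forall a : A, regular a -> invertible a.

Definition zero_ring : Type := unit.

Section ZeroRing.
Let op2 (_ _ : zero_ring) : zero_ring := tt.
Let op1 (_ : zero_ring) : zero_ring := tt.

Fact zero_ringA : associative op2. Proof. by []. Qed.
Fact zero_ringC : commutative op2. Proof. by []. Qed.
Fact zero_ring_id : left_id (tt : zero_ring) op2. Proof. by case. Qed.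
Fact zero_ringN : left_inverse (tt : zero_ring) op1 op2. Proof. by []. Qed.
Fact zero_ringD : left_distributive op2 op2. Proof. by []. Qed.

HB.instance Definition _ := Choice.on zero_ring.
HB.instance Definition _ :=
  GRing.isZmodule.Build zero_ring zero_ringA zero_ringC zero_ring_id zero_ringN.
HB.instance Definition _ :=
  GRing.Zmodule_isComPzRing.Build zero_ring
    zero_ringA zero_ringC zero_ring_id zero_ringD.
End ZeroRing.

(* The ideals of ring_quotient.v are proper ideals of nontrivial rings; here
   any ideal of any commutative ring is needed. *)
HB.mixin Record isIdeal (A : comPzRingType) (I : A -> bool) := {
  ideal_mul_subproof : forall a : A, {in I, forall u, a * u \in I}
}.

#[short(type="ideal")]
HB.structure Definition Ideal (A : comPzRingType) :=
  {I of GRing.ZmodClosed A I & isIdeal A I}.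

Section Quotient.
Variables (A : comPzRingType) (I : ideal A).

Lemma idealM (a u : A) : u \in I -> a * u \in I.
Proof. exact: ideal_mul_subproof. Qed.

Definition quotient_ring : Type := Quotient.quot I.

HB.instance Definition _ := GRing.Zmodule.on quotient_ring.

Definition quotient_pi (a : A) : quotient_ring := \pi_(Quotient.quot I) a.
Definition quotient_one : quotient_ring := quotient_pi 1.
Definition quotient_mul (x y : quotient_ring) : quotient_ring :=
  quotient_pi (repr (x : Quotient.quot I) * repr (y : Quotient.quot I)).

Lemma quotient_piP (a b : A) :
  reflect (quotient_pi a = quotient_pi b) (a - b \in I).
Proof. by rewrite Quotient.idealrBE; apply: eqP. Qed.

Lemma quotient_piK (x : quotient_ring) :
  quotient_pi (repr (x : Quotient.quot I)) = x.
Proof. exact: reprK. Qed.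

Lemma quotient_piD : {morph quotient_pi : a b / a + b}.
Proof. exact: Quotient.pi_add. Qed.

Lemma quotient_piM (a b : A) :
  quotient_mul (quotient_pi a) (quotient_pi b) = quotient_pi (a * b).
Proof.
rewrite /quotient_mul.
set a' := repr _; set b' := repr _.
have Ha : a' - a \in I by apply/quotient_piP; rewrite quotient_piK.
have Hb : b' - b \in I by apply/quotient_piP; rewrite quotient_piK.
apply/quotient_piP.
rewrite -(subrK (a' * b) (a' * b')) -mulrBr -addrA -mulrBl.
by apply: rpredD; [|rewrite mulrC]; apply: idealM.
Qed.

Lemma quotient_mulA : associative quotient_mul.
Proof.
move=> x y z; rewrite -(quotient_piK x) -(quotient_piK y) -(quotient_piK z).
by rewrite !quotient_piM mulrA.
Qed.

Lemma quotient_mulC : commutative quotient_mul.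
Proof. by move=> x y; rewrite /quotient_mul mulrC. Qed.

Lemma quotient_mul1 : left_id quotient_one quotient_mul.
Proof. by move=> x; rewrite -(quotient_piK x) quotient_piM mul1r. Qed.

Lemma quotient_mulD : left_distributive quotient_mul +%R.
Proof.
move=> x y z; rewrite -(quotient_piK x) -(quotient_piK y) -(quotient_piK z).
by rewrite -quotient_piD !quotient_piM mulrDl quotient_piD.
Qed.

HB.instance Definition _ := GRing.Zmodule_isComPzRing.Build quotient_ring
  quotient_mulA quotient_mulC quotient_mul1 quotient_mulD.

Fact quotient_pi_zmod_morphism : zmod_morphism quotient_pi.
Proof. by move=> a b; rewrite quotient_piD; congr (_ + _); apply: Quotient.pi_opp. Qed.

Fact quotient_pi_monoid_morphism : monoid_morphism quotient_pi.
Proof. by split=> // a b; rewrite -quotient_piM. Qed.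

HB.instance Definition _ :=
  GRing.isZmodMorphism.Build A quotient_ring quotient_pi quotient_pi_zmod_morphism.
HB.instance Definition _ :=
  GRing.isMonoidMorphism.Build A quotient_ring quotient_pi
    quotient_pi_monoid_morphism.
End Quotient.

Section PrincipalIdeal.
Variables (A : comPzRingType) (a : A).

Definition principal : A -> bool := fun x => `[< exists c : A, x = c * a >].

Fact principal_zmod : zmod_closed principal.
Proof.
split=> [|x y /asboolP[c ->] /asboolP[d ->]]; apply/asboolP.
  by exists 0; rewrite mul0r.
by exists (c - d); rewrite mulrBl.
Qed.

Fact principal_mul (c : A) : {in principal, forall u, c * u \in principal}.
Proof.
by move=> u /asboolP[d ->]; apply/asboolP; exists (c * d); rewrite mulrA.
Qed.

HB.instance Definition _ := GRing.isZmodClosed.Build A principal principal_zmod.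
HB.instance Definition _ := isIdeal.Build A principal principal_mul.
End PrincipalIdeal.

Section ZeroDivisorGraph.
Variable A : comPzRingType.

Definition sim (a b : A) : bool := `[< principal a =i principal b >].

Lemma sim_equiv : equiv_class_of sim.
Proof.
split=> [a|a b|b a c]; first exact/asboolP.
  by apply/asboolP/asboolP => h x; rewrite h.
by move=> /asboolP h1 /asboolP h2; apply/asboolP => x; rewrite h1.
Qed.

Canonical sim_equivRel := EquivRelPack sim_equiv.
Canonical sim_encModRel := defaultEncModRel sim.

Definition zeta_vertex : Type := {eq_quot sim}.
Definition zeta_class (a : A) : zeta_vertex := \pi_({eq_quot sim}) a.

Definition zeta_adj : rel zeta_vertex := fun x y =>
  repr (x : {eq_quot sim}) * repr (y : {eq_quot sim}) == 0.

Lemma zeta_adjC : symmetric zeta_adj.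
Proof. by move=> x y; rewrite /zeta_adj mulrC. Qed.

Lemma simP (a b : A) :
  reflect ((exists c, a = c * b) /\ (exists d, b = d * a)) (sim a b).
Proof.
apply: (iffP (asboolP _)) => [h|[[c Ec] [d Ed]] x].
  have Pp (z : A) : z \in principal z by apply/asboolP; exists 1; rewrite mul1r.
  by split; apply/asboolP; [move: (Pp a); rewrite h | move: (Pp b); rewrite -h].
by apply/asboolP/asboolP => -[e ->];
  [exists (e * c); rewrite Ec | exists (e * d); rewrite Ed]; rewrite mulrA.
Qed.

Lemma zeta_adjE (a b : A) :
  zeta_adj (zeta_class a) (zeta_class b) = (a * b == 0).
Proof.
have rP z : sim (repr (zeta_class z : {eq_quot sim})) z.
  by apply/eqmodP; rewrite reprK.
rewrite /zeta_adj; case/simP: (rP a) => -[c Ec] [c' Ec'].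
case/simP: (rP b) => -[d Ed] [d' Ed'].
apply/eqP/eqP => h.
  by rewrite Ec' Ed' mulrACA h mulr0.
by rewrite Ec Ed mulrACA h mulr0.
Qed.

Definition zeta : graph := Graph zeta_adjC.
End ZeroDivisorGraph.

(* Main.v *)
Require Import Defs.
From mathcomp Require Import all_boot all_order all_algebra.
From HB Require Import structures.
From mathcomp Require Import boolp.

(** Let [phi] be the isomorphism from [zeta A] to the product, and choose [a]
    and [b] in [A] whose classes it sends to [([1], [0])] and [([0], [1])].
    In any [zeta B] the vertex [[0]] is adjacent to everything, and it is the
    only neighbour of [[1]]; so adjacency to [phi [a]] (resp. [phi [b]]) tests
    whether the first (resp. second) coordinate is [[0]].  Hence [a * b = 0],
    and an element annihilated by both [a] and [b] is zero.

    The key point is that [a + b] is regular.  If [(a + b) * x = 0], then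
    [a * (a * x) = 0]; but [a * x] is also annihilated by [b], so [a * x = 0],
    and likewise [b * x = 0], whence [x = 0].  As [A] is total, [a + b] is a
    unit, and dividing [a] and [b] by it yields complementary orthogonal
    idempotents [e] and [f] with the same annihilators
    ([zeta_prod_idempotents]).

    Complementary idempotents split [A] as [A / (f) * A / (e)]
    ([idempotent_ring_iso]).  Multiplication by [e] identifies [A / (f)] with
    the elements killed by [f], that is, with those whose image under [phi]
    has second coordinate [[0]]; these form a copy of [zeta B1] inside the
    product, because [[0]] is a looped vertex.  So the first coordinate gives
    an isomorphism from [zeta (A / (f))] to [zeta B1]
    ([zeta_quotient_idempotent]), and exchanging the factors gives the one for
    [B2]. *)

Set Implicit Arguments.
Unset Strict Implicit.
Unset Printing Implicit Defensive.

Import GRing.Theory.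

Local Open Scope ring_scope.
Local Open Scope quotient_scope.

Definition principal_ideal (A : comPzRingType) (a : A) : ideal A :=
  HB.pack (principal a).

Section ZetaVertices.
Variable A : comPzRingType.
Implicit Types (a b : A) (x : zeta A).

Lemma zeta_classP a b :
  zeta_class a = zeta_class b <->
  (exists c, a = c * b) /\ (exists d, b = d * a).
Proof.
split=> [/eqmodP/simP //|h].
by apply/eqmodP/simP.
Qed.

Definition zeta_repr x : A := repr (x : {eq_quot (@sim A)}).

Lemma zeta_reprK x : zeta_class (zeta_repr x) = x.
Proof. exact: reprK. Qed.

Lemma adj_zeta0 x : adj x (zeta_class 0 : zeta A).
Proof. by rewrite -(zeta_reprK x) /= zeta_adjE mulr0. Qed.

Lemma zeta_class_eq0 a : zeta_class a = zeta_class 0 <-> a = 0.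
Proof.
split=> [/zeta_classP[[c ->] _]|-> //].
by rewrite mulr0.
Qed.

Lemma adj_zeta1 x : adj x (zeta_class 1 : zeta A) <-> x = zeta_class 0.
Proof.
rewrite -(zeta_reprK x) /= zeta_adjE mulr1 zeta_class_eq0.
by split=> /eqP.
Qed.

End ZetaVertices.

Section ComplementaryIdempotents.
Variables (A : comPzRingType) (e f : A).
Hypotheses (ef1 : e + f = 1) (ef0 : e * f = 0).

Lemma idem_mul (x : A) : e * (e * x) = e * x.
Proof.
have ee : e * e = e by rewrite -[RHS]mulr1 -ef1 mulrDr ef0 addr0.
by rewrite mulrA ee.
Qed.

Lemma idem_split (x : A) : x = e * x + f * x.
Proof. by rewrite -mulrDl ef1 mul1r. Qed.

Lemma idem_fixed (x : A) : f * x = 0 -> e * x = x.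
Proof. by move=> fx0; rewrite {2}(idem_split x) fx0 addr0. Qed.

Lemma mem_principal_idem (x : A) : x \in principal_ideal f <-> e * x = 0.
Proof.
split=> [/asboolP[c ->]|ex0]; first by rewrite mulrCA ef0 mulr0.
by apply/asboolP; exists x; rewrite {1}(idem_split x) ex0 add0r mulrC.
Qed.

Lemma quotient_pi_idemP (x y : A) :
  quotient_pi (principal_ideal f) x = quotient_pi (principal_ideal f) y <->
  e * x = e * y.
Proof.
split=> [/quotient_piP/mem_principal_idem|exy].
  by rewrite mulrBr => /eqP; rewrite subr_eq0 => /eqP.
by apply/quotient_piP/mem_principal_idem; rewrite mulrBr exy subrr.
Qed.

(** As [e] maps to [1] in the quotient by [f], a divisibility relation there
    and the same relation multiplied by [e] in [A] carry the same
    information. *)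
Lemma zeta_class_quotient (x y : A) :
  zeta_class (quotient_pi (principal_ideal f) x) =
    zeta_class (quotient_pi (principal_ideal f) y) <->
  zeta_class (e * x) = zeta_class (e * y).
Proof.
have one_side (u v : A) :
    (exists c, quotient_pi (principal_ideal f) u = c * quotient_pi (principal_ideal f) v)
    <-> exists c, e * u = c * (e * v).
  split=> -[c uv].
    exists (repr (c : Quotient.quot (principal_ideal f))).
    move: uv; rewrite -{1}(quotient_piK c) -rmorphM => /quotient_pi_idemP ->.
    by rewrite mulrCA.
  exists (quotient_pi _ c); rewrite -rmorphM; apply/quotient_pi_idemP.
  by rewrite uv mulrCA.
by rewrite !zeta_classP !one_side.
Qed.

(** [phi] need only send the summand [e A] onto a copy of [G] inside the
    product, sitting over the single vertex [o]; the loop at [o] makes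
    adjacency in this copy the adjacency of [G]. *)
Lemma zeta_quotient_idempotent (G H : graph) (o : H)
    (phi : zeta A -> graph_prod G H) :
  bijective phi -> {mono phi : x y / adj x y} -> adj o o ->
  (forall x, f * x = 0 <-> (phi (zeta_class x)).2 = o) ->
  graph_iso (zeta (quotient_ring (principal_ideal f))) G.
Proof.
move=> [psi phiK psiK] phi_adj oo phi_o.
pose lift (x : zeta (quotient_ring (principal_ideal f))) : A :=
  repr (zeta_repr x : Quotient.quot (principal_ideal f)).
have liftK x : zeta_class (quotient_pi (principal_ideal f) (lift x)) = x.
  by rewrite quotient_piK zeta_reprK.
have phi_e x : (phi (zeta_class (e * x))).2 = o.
  by apply/phi_o; rewrite mulrA [f * e]mulrC ef0 mul0r.
exists (fun x => (phi (zeta_class (e * lift x))).1).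
  exists (fun g => zeta_class (quotient_pi (principal_ideal f)
                                 (zeta_repr (psi (g, o))))) => [x | g] /=.
    have -> : ((phi (zeta_class (e * lift x))).1, o) =
              phi (zeta_class (e * lift x)).
      by rewrite -(phi_e (lift x)); case: (phi _).
    rewrite phiK -[RHS]liftK; apply/zeta_class_quotient.
    (* [e * lift x] and the representative of its class generate the same
       ideal, and this survives multiplication by [e]. *)
    set z := zeta_repr _.
    have /zeta_classP[[c zc] [d ed]] : zeta_class z = zeta_class (e * lift x).
      exact: zeta_reprK.
    apply/zeta_classP; split.
      by exists c; rewrite zc mulrCA idem_mul.
    by exists d; rewrite -[LHS]idem_mul {1}ed mulrCA.
  set z := zeta_repr _.
  have zE : zeta_class z = psi (g, o) by exact: zeta_reprK.
  have ez : e * z = z by apply/idem_fixed/phi_o; rewrite zE psiK.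
  have /zeta_class_quotient -> :=
    liftK (zeta_class (quotient_pi (principal_ideal f) z)).
  by rewrite ez zE psiK.
move=> x y /=.
have /= adjE := phi_adj (zeta_class (e * lift x)) (zeta_class (e * lift y)).
rewrite /prod_adj !phi_e oo andbT in adjE.
rewrite adjE zeta_adjE -{2}(liftK x) -{2}(liftK y) zeta_adjE -rmorphM.
rewrite mulrACA -mulrA idem_mul.
apply/eqP/eqP => [exy|].
  by rewrite -(rmorph0 (quotient_pi (principal_ideal f))); apply/quotient_pi_idemP;
    rewrite mulr0.
rewrite -(rmorph0 (quotient_pi (principal_ideal f))) => /quotient_pi_idemP ->.
by rewrite mulr0.
Qed.

End ComplementaryIdempotents.

Section QuotientPair.
Variables (A : comPzRingType) (I J : ideal A).

Definition quotient_pair (x : A) :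
  (quotient_ring I * quotient_ring J)%type :=
  (quotient_pi I x, quotient_pi J x).

Fact quotient_pair_zmod_morphism : zmod_morphism quotient_pair.
Proof. by move=> x y; rewrite /quotient_pair !rmorphB. Qed.

Fact quotient_pair_monoid_morphism : monoid_morphism quotient_pair.
Proof. by split=> [|x y]; rewrite /quotient_pair ?rmorph1 ?rmorphM. Qed.

HB.instance Definition _ :=
  GRing.isZmodMorphism.Build _ _ _ quotient_pair_zmod_morphism.
HB.instance Definition _ :=
  GRing.isMonoidMorphism.Build _ _ _ quotient_pair_monoid_morphism.

End QuotientPair.

Lemma idempotent_ring_iso (A : comPzRingType) (e f : A) :
  e + f = 1 -> e * f = 0 ->
  ring_iso A (quotient_ring (principal_ideal f) *
              quotient_ring (principal_ideal e))%type.
Proof.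
move=> ef1 ef0.
have fe1 : f + e = 1 by rewrite addrC.
have fe0 : f * e = 0 by rewrite mulrC.
exists (quotient_pair (principal_ideal f) (principal_ideal e)).
exists (fun p => e * repr (p.1 : Quotient.quot (principal_ideal f))
               + f * repr (p.2 : Quotient.quot (principal_ideal e)))
  => [x|[p q]] /=.
  rewrite [RHS](idem_split ef1); congr (_ + _).
    by apply/(quotient_pi_idemP ef1 ef0); rewrite quotient_piK.
  by apply/(quotient_pi_idemP fe1 fe0); rewrite quotient_piK.
rewrite /quotient_pair; congr (_, _).
  rewrite -[RHS]quotient_piK; apply/(quotient_pi_idemP ef1 ef0).
  by rewrite mulrDr (idem_mul ef1 ef0) [e * (f * _)]mulrA ef0 mul0r addr0.
rewrite -[RHS]quotient_piK; apply/(quotient_pi_idemP fe1 fe0).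
by rewrite mulrDr (idem_mul fe1 fe0) [f * (e * _)]mulrA fe0 mul0r add0r.
Qed.

(** A product decomposition of [zeta A] is realised by idempotents: the
    elements of [A] over the two vertices [([1], [0])] and [([0], [1])] add up
    to a regular element, hence to a unit, and are idempotent after division
    by it. *)
Lemma zeta_prod_idempotents (A B1 B2 : comPzRingType)
    (phi : zeta A -> graph_prod (zeta B1) (zeta B2)) :
  total_ring A -> bijective phi -> {mono phi : x y / adj x y} ->
  exists e f : A,
    [/\ e + f = 1, e * f = 0,
        forall x, e * x = 0 <-> (phi (zeta_class x)).1 = zeta_class 0
      & forall x, f * x = 0 <-> (phi (zeta_class x)).2 = zeta_class 0].
Proof.
move=> A_total [psi phiK psiK] phi_adj.
pose a := zeta_repr (psi (zeta_class 1, zeta_class 0)).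
pose b := zeta_repr (psi (zeta_class 0, zeta_class 1)).
have phi_a : phi (zeta_class a) = (zeta_class 1, zeta_class 0).
  by rewrite zeta_reprK psiK.
have phi_b : phi (zeta_class b) = (zeta_class 0, zeta_class 1).
  by rewrite zeta_reprK psiK.
have mul0E (x y : A) :
    x * y = 0 <-> adj (phi (zeta_class y)) (phi (zeta_class x)).
  by rewrite phi_adj /= zeta_adjE mulrC; split=> /eqP.
have ann_a x : a * x = 0 <-> (phi (zeta_class x)).1 = zeta_class 0.
  rewrite mul0E phi_a; split=> [/andP[/adj_zeta1 //]|x1].
  by apply/andP; split; [apply/adj_zeta1 | apply: adj_zeta0].
have ann_b x : b * x = 0 <-> (phi (zeta_class x)).2 = zeta_class 0.
  rewrite mul0E phi_b; split=> [/andP[_ /adj_zeta1 //]|x2].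
  by apply/andP; split; [apply: adj_zeta0 | apply/adj_zeta1].
have ab0 : a * b = 0 by apply/ann_a; rewrite phi_b.
have ba0 : b * a = 0 by rewrite mulrC.
have ann_ab x : a * x = 0 -> b * x = 0 -> x = 0.
  move=> /ann_a x1 /ann_b x2; rewrite -[x]mulr1; apply/mul0E.
  have -> : phi (zeta_class x) = (zeta_class 0, zeta_class 0).
    by rewrite -x1 -x2; case: (phi _).
  by apply/andP; split; apply: adj_zeta0.
have [|u abu] := A_total (a + b).
  (* To get [x = 0], first get [a * x = 0] and [b * x = 0], each by showing
     that it is annihilated by both [a] and [b]. *)
  move=> x abx0; apply: (ann_ab); apply: (ann_ab).
  - by rewrite -[RHS](mulr0 a) -abx0 mulrDl mulrDr [a * (b * x)]mulrA ab0 mul0r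
               addr0.
  - by rewrite mulrA ba0 mul0r.
  - by rewrite mulrA ab0 mul0r.
  - by rewrite -[RHS](mulr0 b) -abx0 mulrDl mulrDr [b * (a * x)]mulrA ba0 mul0r
               add0r.
have ann_unit (c x : A) : c * u * x = 0 <-> c * x = 0.
  rewrite mulrAC; split=> [cxu0|->]; last by rewrite mul0r.
  by rewrite -[c * x]mulr1 -abu [(a + b) * u]mulrC mulrA cxu0 mul0r.
exists (a * u), (b * u); split=> [||x|x].
- by rewrite -mulrDl.
- by rewrite mulrACA ab0 mul0r.
- by rewrite ann_unit ann_a.
- by rewrite ann_unit ann_b.
Qed.

Theorem corollary3p22 (A B1 B2 : comPzRingType)
    (A_total : total_ring A)
    (zetaA : graph_iso (zeta A) (graph_prod (zeta B1) (zeta B2)))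
    (zetaB1 : ~ graph_iso (zeta B1) (zeta zero_ring))
    (zetaB2 : ~ graph_iso (zeta B2) (zeta zero_ring)) :
  exists I1 I2 : ideal A,
    [/\ ring_iso A (quotient_ring I1 * quotient_ring I2)%type,
        graph_iso (zeta (quotient_ring I1)) (zeta B1)
      & graph_iso (zeta (quotient_ring I2)) (zeta B2)].
Proof.
have [phi phi_bij phi_adj] := zetaA.
have [e [f [ef1 ef0 ann_e ann_f]]] :=
  zeta_prod_idempotents A_total phi_bij phi_adj.
exists (principal_ideal f), (principal_ideal e); split.
- exact: idempotent_ring_iso.
- apply: (zeta_quotient_idempotent ef1 ef0 phi_bij phi_adj _ ann_f).
  exact: adj_zeta0.
pose swap (p : graph_prod (zeta B1) (zeta B2)) :
  graph_prod (zeta B2) (zeta B1) := (p.2, p.1).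
have swap_bij : bijective swap.
  by exists (fun p => (p.2, p.1)); case.
have swap_adj : {mono swap \o phi : x y / adj x y}.
  by move=> x y; rewrite -phi_adj /= /prod_adj andbC.
have fe1 : f + e = 1 by rewrite addrC.
have fe0 : f * e = 0 by rewrite mulrC.
apply: (zeta_quotient_idempotent fe1 fe0 (bij_comp swap_bij phi_bij) swap_adj
          _ ann_e).
exact: adj_zeta0.
Qed.
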